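(* Let $y=y(x)$ be a differentiable function on an interval $I\subseteq\mathbb{R}$. Suppose its tangent lines are the family of lines $$y = m(k)\,x - d(m(k)),$$ where $k$ is a parameter that need not have any particular geometric significance. Let $f$ be the function such that $d(m(k)) = -f(m(k))$ for all values of the parameter $k$. Then every tangent line of the family and the curve $y=y(x)$ itself (the envelope of the family) are solutions of Clairaut's differential equation $$y = x\,y' + f(y').$$
   Context: The tangent lines of the curve are written in the form $y = mx - d$, where $m$ is the slope and $d$ is the negation of the $y$-intercept. That the family $y=m(k)x-d(m(k))$ is the family of tangent lines of the curve $y=y(x)$ means: each member is the tangent line to the curve at some point $(h,y(h))$, $h\in I$, and for every $h\in I$ the tangent line at $(h,y(h))$ is a member of the family, i.e. there is a parameter value $k$ with $m(k)=y'(h)$ and $-d(m(k)) = y(h)-h\,y'(h)$. Here $d$ is a function of the slope. An envelope of a family of lines is a curve that is tangent to each member of the family and that comprises those points of tangency. A differentiable function $g$ is a solution of Clairaut's equation if $g(x)=x\,g'(x)+f(g'(x))$ for all $x$ in its domain. *)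

(* Defs.v *)
From Stdlib Require Import Reals.
Open Scope R_scope.

(* An order-convex set with at least two points: open, closed, half-open,
   bounded or unbounded. *)
Definition is_interval (I : R -> Prop) : Prop :=
  (forall a b x, I a -> I b -> a <= x <= b -> I x) /\
  (exists a b, I a /\ I b /\ a < b).

(* [D_in] takes the limit of the difference quotient inside [I], so at an
   endpoint of [I] the derivative is the one-sided one.  It is unique when [I]
   is an interval in the above sense. *)
Definition has_derivative_at (I : R -> Prop) (g : R -> R) (h s : R) : Prop :=
  D_in g (fun _ => s) I h.

Definition derivative_on (I : R -> Prop) (g g' : R -> R) : Prop :=
  forall x, I x -> has_derivative_at I g x (g' x).

Definition differentiable_on (I : R -> Prop) (g : R -> R) : Prop :=
  exists g', derivative_on I g g'.

(* The line Y = s * X + c is the tangent line, at the point (h, g h), of the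
   graph of [g] over [I]. *)
Definition is_tangent_line (I : R -> Prop) (g : R -> R) (h s c : R) : Prop :=
  I h /\ has_derivative_at I g h s /\ c = g h - h * s.

Definition line_of {K : Type} (m : K -> R) (d : R -> R) (k : K) : R -> R :=
  fun x => m k * x - d (m k).

Definition is_tangent_family (I : R -> Prop) (g : R -> R)
    {K : Type} (m : K -> R) (d : R -> R) : Prop :=
  (forall k, exists h, is_tangent_line I g h (m k) (- d (m k))) /\
  (forall h, I h -> exists k, is_tangent_line I g h (m k) (- d (m k))).

(* The graph of [g] over [I] and the graph of [L] over R meet at abscissa [h]
   with the same slope. *)
Definition tangent_at (I : R -> Prop) (g L : R -> R) (h : R) : Prop :=
  I h /\ g h = L h /\
  exists s, has_derivative_at I g h s /\ derivable_pt_lim L h s.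

(* The graph of [g] over [I] touches every member of the family [L], and
   consists of points of tangency. *)
Definition is_envelope (I : R -> Prop) (g : R -> R)
    {K : Type} (L : K -> R -> R) : Prop :=
  (forall k, exists h, tangent_at I g (L k) h) /\
  (forall h, I h -> exists k, tangent_at I g (L k) h).

Definition clairaut_solution (D : R -> Prop) (f g : R -> R) : Prop :=
  exists g', derivative_on D g g' /\
    forall x, D x -> g x = x * g' x + f (g' x).

(* Main.v *)
Require Import Defs.
From Stdlib Require Import Reals Lra.
Open Scope R_scope.

(** Clairaut's equation for a curve says that the intercept of each of its
    tangent lines is [f] of the slope.  A line is everywhere its own tangent,
    so for the member with parameter [k] the equation is the relation
    [- d (m k) = f (m k)] that defines [f].  The curve has at each abscissa
    [h] a tangent line belonging to the family, so its equation at [h] is that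
    of this line, evaluated at the point of contact.

    The last step identifies the derivative of [y] at [h] with the slope [m k]
    of a member of the family tangent there, which needs the derivative
    relative to [I] to be unique ([has_derivative_at_unique]); this rests on
    every point of a nondegenerate interval being a limit of other points of
    it ([interval_accumulation]). *)

(** One of two distinct elements of the interval differs from [h]; by
    convexity the interval contains the segment from [h] towards it, hence
    points arbitrarily close to [h]. *)
Lemma interval_accumulation (I : R -> Prop) (h : R) :
  is_interval I -> I h -> adhDa (D_x I h) h.
Proof.
intros [conv [a [b [Ia [Ib ltab]]]]] Ih eps epos.
unfold D_x, Rdist.
destruct (Rlt_le_dec h b) as [lthb | lebh].
- exists (Rmin b (h + eps / 2)).
  assert (Hx : h < Rmin b (h + eps / 2)) by (apply Rmin_glb_lt; lra).
  pose proof (Rmin_l b (h + eps / 2)).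
  pose proof (Rmin_r b (h + eps / 2)).
  split; [split|].
  + apply (conv h b); [exact Ih | exact Ib | lra].
  + lra.
  + apply Rabs_def1; lra.
- exists (Rmax a (h - eps / 2)).
  assert (Hx : Rmax a (h - eps / 2) < h) by (apply Rmax_lub_lt; lra).
  pose proof (Rmax_l a (h - eps / 2)).
  pose proof (Rmax_r a (h - eps / 2)).
  split; [split|].
  + apply (conv a h); [exact Ia | exact Ih | lra].
  + lra.
  + apply Rabs_def1; lra.
Qed.

Lemma has_derivative_at_unique (I : R -> Prop) (g : R -> R) (h s t : R) :
  is_interval I -> I h ->
  has_derivative_at I g h s -> has_derivative_at I g h t -> s = t.
Proof.
intros hI Ih Hs Ht.
exact (single_limit _ _ _ _ _ (interval_accumulation I h hI Ih) Hs Ht).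
Qed.

Lemma line_of_derivative {K : Type} (m : K -> R) (d : R -> R) (k : K) (x : R) :
  derivable_pt_lim (line_of m d k) x (m k).
Proof.
replace (m k) with (m k * 1 - 0) at 1 by ring.
apply derivable_pt_lim_minus.
- apply derivable_pt_lim_scal, derivable_pt_lim_id.
- apply derivable_pt_lim_const.
Qed.

Lemma line_of_clairaut {K : Type} (m : K -> R) (d f : R -> R) (k : K) :
  d (m k) = - f (m k) ->
  clairaut_solution (fun _ => True) f (line_of m d k).
Proof.
intros hf.
exists (fun _ => m k); split.
- intros x _.
  apply (derivable_pt_lim_D_in (line_of m d k) (fun _ => m k) x).
  apply line_of_derivative.
- intros x _; unfold line_of; rewrite hf; ring.
Qed.

Lemma is_tangent_line_tangent_at (I : R -> Prop) (g : R -> R) {K : Type}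
    (m : K -> R) (d : R -> R) (k : K) (h : R) :
  is_tangent_line I g h (m k) (- d (m k)) -> tangent_at I g (line_of m d k) h.
Proof.
intros [Ih [Hd Hc]].
split; [exact Ih | split].
- unfold line_of; lra.
- exists (m k); split; [exact Hd | apply line_of_derivative].
Qed.

Theorem theorem6p1 (I : R -> Prop) (y : R -> R) (K : Type) (m : K -> R)
    (d f : R -> R)
    (hI : is_interval I)
    (hy : differentiable_on I y)
    (htan : is_tangent_family I y m d)
    (hf : forall k : K, d (m k) = - f (m k)) :
  (forall k : K, clairaut_solution (fun _ => True) f (line_of m d k)) /\
  clairaut_solution I f y /\
  is_envelope I y (line_of m d).
Proof.
destruct htan as [touches covers].
split; [|split].
- intros k; apply line_of_clairaut, hf.
- destruct hy as [y' Hy'].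
  exists y'; split; [exact Hy'|].
  intros h Ih.
  destruct (covers h Ih) as [k [_ [Hd Hc]]].
  rewrite (has_derivative_at_unique I y h _ _ hI Ih (Hy' h Ih) Hd).
  rewrite hf in Hc; lra.
- split.
  + intros k; destruct (touches k) as [h Hh].
    exists h; apply is_tangent_line_tangent_at, Hh.
  + intros h Ih; destruct (covers h Ih) as [k Hk].
    exists k; apply is_tangent_line_tangent_at, Hk.
Qed.
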